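(* The semi-discrete formulations of Problem (I) and Problem (C) described in the context, namely: given $\xi_0\in\mathscr Z_h$, for all $t\in(0,T)$ find $\xi_h(t)\in\mathscr{Z}_h$ such that $F^i(t,\xi_h,\xi_h')=0$ for all $i=1,\dots,N_V+N_Q+N_Y$, are strongly consistent. That is, if $\xi=(\boldsymbol{u},p,\boldsymbol{w})$ is the exact solution of Problem (I) (respectively, Problem (C)), then $$F^i(t,\xi,\xi')=\langle\mathcal{F}(t,\xi,\xi'),\psi_h^i\rangle=0,\qquad i=1,\dots,N_V+N_Q+N_Y,$$ for any conforming approximation, i.e. whenever $\mathscr{V}_h\subseteq\mathscr{V}$, $\mathscr{Q}_h\subseteq\mathscr{Q}$ and $\mathscr{Y}_h\subseteq\mathscr{Y}$.
   Context: Geometry. $d\in\{2,3\}$; $\Omega\subset\mathbb{R}^d$ is a fixed control volume, $\partial\Omega=\partial\Omega_D\cup\partial\Omega_N$ with $\partial\Omega_D\cap\partial\Omega_N=\emptyset$. $B\subset\mathbb{R}^d$ is the fixed reference configuration of the solid. For a displacement $\boldsymbol{w}(\boldsymbol{s},t)$, $\boldsymbol{s}\in B$, the motion is $\boldsymbol{s}+\boldsymbol{w}(\boldsymbol{s},t)$, a diffeomorphism of $B$ onto $B_t\subset\Omega$; $\mathsf{F}[\boldsymbol{w}]=\mathsf{I}+\nabla_{\boldsymbol{s}}\boldsymbol{w}$, $J[\boldsymbol{w}]=\det\mathsf{F}[\boldsymbol{w}]\ge J_m>0$. A prime is the partial derivative in $t$; dots between tensors are the Frobenius inner product. For a function $g$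 on $\Omega$, $g|_{\boldsymbol{w}}$ denotes $g(\boldsymbol{x})$ at $\boldsymbol{x}=\boldsymbol{s}+\boldsymbol{w}(\boldsymbol{s},t)$. Spaces. $\mathscr{V}=\{\boldsymbol{u}\in H^1(\Omega)^d:\boldsymbol{u}|_{\partial\Omega_D}=\boldsymbol{u}_g\}$, $\mathscr{V}_0=\{\boldsymbol{v}\in H^1(\Omega)^d:\boldsymbol{v}|_{\partial\Omega_D}=\boldsymbol{0}\}$, $\mathscr{Q}=L^2(\Omega)$, $\mathscr{Y}=\{\boldsymbol{w}\in L^2(B)^d:\nabla_{\boldsymbol{s}}\boldsymbol{w}\in L^\infty(B)^{d\times d}\}$, $\mathscr{H}_Y=H^1(B)^d$; $\mathscr{Z}=\mathscr{V}\times\mathscr{Q}\times\mathscr{Y}$, $\mathscr{Z}_0=\mathscr{V}_0\times\mathscr{Q}\times\mathscr{H}_Y$. $\boldsymbol{u}'$ belongs to a pivot space $\mathscr{H}_V$ with $\mathscr{V}\subseteq\mathscr{H}_V\subseteq\mathscr{H}_V^*\subseteq\mathscr{V}^*$, and $\boldsymbol{w}'\in\mathscr{H}_Y$. Constitutive data. $\rho_{\mathrm f}$ is the constant fluid density (extended to all of $\Omega$), $\rho_{\mathrm s_0}(\boldsymbol{s})$ the referential solid density, $\mu_{\mathrm f}>0$, $\mu_{\mathrm s}\ge0$; $\hat{\mathsf T}^v_{a}[\boldsymbol{u}]=\mu_a(\nabla\boldsymbol{u}+(\nabla\boldsymbol{u})^{\mathrm T})$ for $a=\mathrm f,\mathrm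 s$. $\hat W^e_{\mathrm s}(\mathsf F)$ is the elastic strain energy density, a $C^1$ convex function on tensors with positive determinant, and $\hat{\mathsf P}^e_{\mathrm s}[\boldsymbol{w}]=\partial\hat W^e_{\mathrm s}/\partial\mathsf F$ at $\mathsf F=\mathsf F[\boldsymbol{w}]$. $\boldsymbol{b}$ is the body force per unit mass, $\boldsymbol{\tau}_g$ the prescribed traction on $\partial\Omega_N$, $\Phi_B>0$ a constant. The functional $\mathcal{F}$. For $\xi=(\boldsymbol{u},p,\boldsymbol{w})$ and $\psi=(\boldsymbol{v},q,\boldsymbol{y})\in\mathscr{Z}_0$, $\langle\mathcal{F}(t,\xi,\xi'),\psi\rangle=R_1(\boldsymbol{v})+R_2(q)+R_3(\boldsymbol{y})$. For Problem (I) (incompressible solid): $R_1(\boldsymbol{v})=\int_\Omega\rho_{\mathrm f}(\boldsymbol{u}'+(\nabla\boldsymbol{u})\boldsymbol{u})\cdot\boldsymbol{v}\,dv+\int_\Omega\hat{\mathsf T}^v_{\mathrm f}[\boldsymbol{u}]\cdot\nabla\boldsymbol{v}\,dv-\int_\Omega p\,\mathrm{div}\,\boldsymbol{v}\,dv+\int_B(\rho_{\mathrm s_0}-\rho_{\mathrm f}J[\boldsymbol{w}])(\boldsymbol{u}'\cdot\boldsymbol{v})|_{\boldsymbol{w}}\,dV+\int_B\{[\rho_{\mathrm s_0}(\nabla\boldsymbol{u})\boldsymbol{w}'-\rho_{\mathrm f}J[\boldsymbol{w}](\nabla\boldsymbol{u})\boldsymbol{u}]\cdot\boldsymbol{v}\}|_{\boldsymbol{w}}\,dV+\int_BJ[\boldsymbol{w}]\{(\hat{\mathsf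 T}^v_{\mathrm s}[\boldsymbol{u}]-\hat{\mathsf T}^v_{\mathrm f}[\boldsymbol{u}])\cdot\nabla\boldsymbol{v}\}|_{\boldsymbol{w}}\,dV+\int_B\hat{\mathsf P}^e_{\mathrm s}[\boldsymbol{w}]\cdot\nabla_{\boldsymbol{s}}(\boldsymbol{v}|_{\boldsymbol{w}})\,dV-\int_\Omega\rho_{\mathrm f}\boldsymbol{b}\cdot\boldsymbol{v}\,dv-\int_{\partial\Omega_N}\boldsymbol{\tau}_g\cdot\boldsymbol{v}\,da-\int_B(\rho_{\mathrm s_0}-\rho_{\mathrm f}J[\boldsymbol{w}])(\boldsymbol{b}\cdot\boldsymbol{v})|_{\boldsymbol{w}}\,dV$, $R_2(q)=-\int_\Omega q\,\mathrm{div}\,\boldsymbol{u}\,dv$, $\quad R_3(\boldsymbol{y})=\Phi_B\int_B[\boldsymbol{w}'-\boldsymbol{u}|_{\boldsymbol{w}}]\cdot\boldsymbol{y}\,dV$. For Problem (C) (compressible solid; constants $c_1>0$, $c_2\in\{0,1\}$): add $\int_BJ[\boldsymbol{w}](p\,\mathrm{div}\,\boldsymbol{v})|_{\boldsymbol{w}}\,dV$ to $R_1$, and add to $R_2$ the terms $\int_BJ[\boldsymbol{w}](q\,\mathrm{div}\,\boldsymbol{u})|_{\boldsymbol{w}}\,dV+c_1\{\int_BJ[\boldsymbol{w}](p\,q)|_{\boldsymbol{w}}\,dV+c_2\int_B\frac{1}{\mathrm{tr}\,\mathsf I}(J[\boldsymbol{w}]\hat{\mathsf T}^v_{\mathrm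 s}[\boldsymbol{u}]|_{\boldsymbol{w}}\cdot\mathsf I+\hat{\mathsf P}^e_{\mathrm s}[\boldsymbol{w}]\cdot\mathsf F[\boldsymbol{w}])\,q|_{\boldsymbol{w}}\,dV\}$. The (exact) Problem (I) or (C) is: given $\xi_0\in\mathscr{Z}$, for all $t\in(0,T)$ find $\xi(t)\in\mathscr{Z}$ with $\langle\mathcal{F}(t,\xi,\xi'),\psi\rangle=0$ for all $\psi\in\mathscr{Z}_0$. Discrete spaces. $\mathscr{V}_h=\mathrm{span}\{\boldsymbol{v}_h^i\}_{i=1}^{N_V}$, $\mathscr{Q}_h=\mathrm{span}\{q_h^i\}_{i=1}^{N_Q}$, $\mathscr{Y}_h=\mathrm{span}\{\boldsymbol{y}_h^i\}_{i=1}^{N_Y}$ are finite element spaces of piecewise polynomials on decompositions of $\Omega$ (first two) and $B$ (third); $\mathscr{Z}_h=\mathscr{V}_h\times\mathscr{Q}_h\times\mathscr{Y}_h$; $\psi_h^i$, $i=1,\dots,N_V+N_Q+N_Y$, are the basis functions of $\mathscr{V}_h$, $\mathscr{Q}_h$, $\mathscr{Y}_h$ (viewed in $\mathscr Z_h$); and $F^i(t,\xi,\xi'):=\langle\mathcal{F}(t,\xi,\xi'),\psi_h^i\rangle$. *)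

(* Defs.v *)
From Stdlib Require List.
From HB Require Import structures.
From mathcomp Require Import all_boot all_order all_algebra.
From mathcomp Require Import all_classical all_reals all_analysis.
From mathcomp Require mpoly.

Set Implicit Arguments.
Unset Strict Implicit.
Unset Printing Implicit Defensive.

Import Order.TTheory GRing.Theory Num.Theory.
Import numFieldNormedType.Exports.

Local Open Scope classical_set_scope.
Local Open Scope ring_scope.

(* Points of R^d, and vectors, are row vectors 'rV[R]_d.  The norm that the
   library puts on them is the sup norm; it is used for topology only. *)

Section euclid.
Context {R : realType} {d : nat}.
Implicit Types (u v : 'rV[R]_d) (A B : 'M[R]_d).

Definition dotv u v : R := \sum_i u 0 i * v 0 i.
Definition frob A B : R := \sum_i \sum_j A i j * B i j.
Definition edist u v : R := Num.sqrt (dotv (u - v) (u - v)).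

(* Matrix-vector product A u, for u stored as a row. *)
Definition appv A u : 'rV[R]_d := u *m A^T.

Definition basis_vec (j : 'I_d) : 'rV[R]_d := delta_mx 0 j.

End euclid.

(* Outer measure generated by a cost on sets:
     inf { sum_k c (F k) | A included in the union of the F k }.
   The sigma-algebra generated by all sets contains every set, so mu_ext
   imposes no restriction on the covers. *)
Section cover_outer.
Context {R : realType} {T : pointedType}.
Variable c : set T -> \bar R.

Definition cost (F : set T) : \bar R :=
  if F == set0 then 0%E else maxe 0%E (c F).

Definition cover_outer : set T -> \bar R :=
  @mu_ext _ (g_sigma_algebraType [set: set T]) R cost.

Lemma cost0 : cost set0 = 0%E.
Proof. by rewrite /cost eqxx. Qed.

Lemma cost_ge0 F : (0 <= cost F)%E.
Proof. by rewrite /cost; case: ifP => // _; rewrite le_max lexx. Qed.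

Lemma cover_outer0 : cover_outer set0 = 0%E.
Proof. exact: (@mu_ext0 _ (g_sigma_algebraType [set: set T]) R cost cost0 cost_ge0). Qed.

Lemma cover_outer_ge0 A : (0 <= cover_outer A)%E.
Proof. exact: (@mu_ext_ge0 _ (g_sigma_algebraType [set: set T]) R cost cost_ge0). Qed.

Lemma le_cover_outer : {homo cover_outer : A B / A `<=` B >-> (A <= B)%E}.
Proof. exact: (@le_mu_ext _ (g_sigma_algebraType [set: set T]) R cost). Qed.

Lemma cover_outer_sigma_subadditive : sigma_subadditive cover_outer.
Proof.
exact: (@mu_ext_sigma_subadditive _ (g_sigma_algebraType [set: set T]) R cost
  cost_ge0).
Qed.

End cover_outer.

Section lebesgue.
Context (R : realType) (d : nat).
Local Notation E := 'rV[R]_d.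

Definition box (a b : E) : set E := [set x | forall i, a 0 i <= x 0 i <= b 0 i].

Definition box_volume (a b : E) : R := \prod_i Num.max 0 (b 0 i - a 0 i).

Definition lebesgue_outer : set E -> \bar R :=
  cover_outer (fun F => ereal_inf
    [set (box_volume ab.1 ab.2)%:E | ab in [set ab : E * E | F `<=` box ab.1 ab.2]]).

HB.instance Definition _ := isOuterMeasure.Build R E lebesgue_outer
  (cover_outer0 _) (cover_outer_ge0 _) (@le_cover_outer _ _ _)
  (@cover_outer_sigma_subadditive _ _ _).

Definition leb : set (caratheodory_type lebesgue_outer) -> \bar R := lebesgue_outer.

HB.instance Definition _ := isMeasure.Build _ _ _ leb
  (@caratheodory_measure0 _ _ lebesgue_outer) (@caratheodory_measure_ge0 _ _ lebesgue_outer)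
  (@caratheodory_measure_sigma_additive _ _ lebesgue_outer).

End lebesgue.
Arguments leb {R d}.

Section hausdorff.
Context (R : realType) (d : nat) (s : nat).
Local Notation E := 'rV[R]_d.

(* Volume of the Euclidean unit ball of R^n, by V_n = (2 pi / n) V_(n-2). *)
Fixpoint unit_ball_volume (n : nat) : R :=
  match n with
  | 0 => 1
  | 1 => 2
  | m.+2 => 2 * pi / n%:R * unit_ball_volume m
  end.

Definition diam (F : set E) : \bar R :=
  ereal_sup [set (edist xy.1 xy.2)%:E | xy in [set xy : E * E | F xy.1 /\ F xy.2]].

(* The normalisation makes the s-dimensional measure agree with the s-dimensional
   volume of smooth surfaces. *)
Definition hausdorff_pre (delta : R) : set E -> \bar R :=
  cover_outer (fun F => if (diam F <= delta%:E)%E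
    then (unit_ball_volume s * (fine (diam F) / 2) ^+ s)%:E else +oo%E).

Definition hausdorff_outer (A : set E) : \bar R :=
  ereal_sup [set hausdorff_pre delta A | delta in [set delta | 0 < delta]].

Lemma hausdorff_outer_ge0 A : (0 <= hausdorff_outer A)%E.
Proof.
apply: (le_trans (cover_outer_ge0 _ A)).
by apply: ereal_sup_ubound; exists 1 => //=; exact: ltr01.
Qed.

Lemma hausdorff_outer0 : hausdorff_outer set0 = 0%E.
Proof.
apply/eqP; rewrite eq_le hausdorff_outer_ge0 andbT.
by apply: ge_ereal_sup => _ [delta _ <-]; rewrite /hausdorff_pre cover_outer0.
Qed.

Lemma le_hausdorff_outer : {homo hausdorff_outer : A B / A `<=` B >-> (A <= B)%E}.
Proof.
move=> A B AB; apply: ge_ereal_sup => _ [delta d0 <-].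
apply: (@le_trans _ _ (hausdorff_pre delta B)); first exact: le_cover_outer.
by apply: ereal_sup_ubound; exists delta.
Qed.

Lemma hausdorff_outer_sigma_subadditive : sigma_subadditive hausdorff_outer.
Proof.
move=> F; apply: ge_ereal_sup => _ [delta d0 <-].
apply: (@le_trans _ _ (\sum_(k <oo) hausdorff_pre delta (F k))%E).
  exact: cover_outer_sigma_subadditive.
apply: lee_nneseries => [k _ _|k _]; first exact: cover_outer_ge0.
by apply: ereal_sup_ubound; exists delta.
Qed.

HB.instance Definition _ := isOuterMeasure.Build R E hausdorff_outer
  hausdorff_outer0 hausdorff_outer_ge0 le_hausdorff_outer
  hausdorff_outer_sigma_subadditive.

Definition hausdorff : set (caratheodory_type hausdorff_outer) -> \bar R := hausdorff_outer.

HB.instance Definition _ := isMeasure.Build _ _ _ hausdorff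
  (@caratheodory_measure0 _ _ hausdorff_outer) (@caratheodory_measure_ge0 _ _ hausdorff_outer)
  (@caratheodory_measure_sigma_additive _ _ hausdorff_outer).

End hausdorff.
Arguments hausdorff_outer R d s : clear implicits.
Arguments hausdorff R d s : clear implicits.

(* Functions on an open set D of R^d are total functions on R^d of which only
   the restriction to D matters; elements of Lebesgue and Sobolev spaces are
   represented by functions rather than by almost-everywhere classes. *)

Section Lp.
Context {disp : measure_display} {T : measurableType disp} {R : realType}.
Variable mu : {measure set T -> \bar R}.

Definition Lp (p : \bar R) (D : set T) (f : T -> R) : Prop :=
  (f \_ D) \in Lfun mu p.

Definition cvgL2 (D : set T) (f : nat -> T -> R) (g : T -> R) : Prop :=
  [/\ forall n, Lp 2%:E D (f n), Lp 2%:E D g &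
      (fun n => 'N[mu]_2%:E [EFin \o ((f n \- g)%R \_ D)]%E) @ \oo --> 0%E].

End Lp.

Section sobolev.
Context {R : realType} {d : nat}.
Local Notation E := 'rV[R]_d.

Definition partial (j : 'I_d) (f : E -> R) : E -> R := 'D_(basis_vec j) f.

Fixpoint Ck (k : nat) (f : E -> R) : Prop :=
  match k with
  | 0 => continuous f
  | k'.+1 => (forall x, differentiable f x) /\ forall j, Ck k' (partial j f)
  end.

Definition smooth (f : E -> R) : Prop := forall k, Ck k f.

Definition test_function (D : set E) (phi : E -> R) : Prop :=
  smooth phi /\
  exists K, [/\ compact K, K `<=` D & forall x, ~ K x -> phi x = 0].

Definition cmpt (u : E -> E) (i : 'I_d) : E -> R := fun x => u x 0 i.
Definition mcmpt (G : E -> 'M[R]_d) (i j : 'I_d) : E -> R := fun x => G x i j.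

(* G is the weak gradient of u on D: G i j is the weak derivative of the i-th
   component in the j-th direction.  Requiring both integrals to exist for every
   test function amounts to local integrability of the integrands. *)
Definition is_weak_gradient (D : set E) (u : E -> E) (G : E -> 'M[R]_d) : Prop :=
  forall i j phi, test_function D phi ->
    [/\ leb.-integrable D (EFin \o (cmpt u i \* partial j phi)),
        leb.-integrable D (EFin \o (mcmpt G i j \* phi)) &
        \int[leb]_(x in D) (cmpt u i x * partial j phi x) =
        - \int[leb]_(x in D) (mcmpt G i j x * phi x)].

(* Weak gradients are unique up to null sets; the value is 0 if there is none. *)
Definition weak_gradient (D : set E) (u : E -> E) : E -> 'M[R]_d :=
  xget (fun=> 0) [set G | is_weak_gradient D u G].

Definition L2vec (D : set E) (u : E -> E) : Prop :=
  forall i, Lp leb 2%:E D (cmpt u i).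

Definition Lp_mat (p : \bar R) (D : set E) (G : E -> 'M[R]_d) : Prop :=
  forall i j, Lp leb p D (mcmpt G i j).

Definition H1vec (D : set E) : set (E -> E) :=
  [set u | L2vec D u /\ exists G, is_weak_gradient D u G /\ Lp_mat 2%:E D G].

Definition H1norm (D : set E) (u : E -> E) : R :=
  Num.sqrt (\int[leb]_(x in D) dotv (u x) (u x) +
    \int[leb]_(x in D) frob (weak_gradient D u x) (weak_gradient D u x)).

(* g is the trace of v on the part Gamma of the boundary of D: some fields smooth
   up to the boundary converge to v in H^1(D) while their restrictions to Gamma
   converge to g for the surface measure.  On a Lipschitz domain this is the graph
   of the usual trace operator, which is the closure of the restriction map. *)
Definition is_trace (D Gamma : set E) (v g : E -> E) : Prop :=
  exists (G : E -> 'M[R]_d) (vn : nat -> E -> E),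
    [/\ is_weak_gradient D v G,
        forall n i, smooth (cmpt (vn n) i),
        forall i, cvgL2 leb D (fun n => cmpt (vn n) i) (cmpt v i),
        forall i j, cvgL2 leb D (fun n => partial j (cmpt (vn n) i)) (mcmpt G i j) &
        forall i, cvgL2 (hausdorff R d d.-1) Gamma
          (fun n => cmpt (vn n) i) (cmpt g i)].

Definition trace (D Gamma : set E) (v : E -> E) : E -> E :=
  xget (fun=> 0) [set g | is_trace D Gamma v g].

Definition C1_on (D : set E) (f : E -> E) : Prop :=
  forall x, D x -> differentiable f x /\ forall v, {for x, continuous ('D_v f)}.

Definition diffeo_on (D : set E) (f : E -> E) : Prop :=
  [/\ C1_on D f, open (f @` D) &
      exists g, (forall x, D x -> g (f x) = x) /\ C1_on (f @` D) g].

(* HV, with inner product ip, is a Hilbert space of (classes of) measurable fields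
   on D, continuously containing V.  It is identified with its dual, and its dual
   with a subspace of the dual of V: the latter restriction map is injective
   exactly when only 0 is orthogonal to V. *)
Definition pivot_space (D : set E) (V HV : set (E -> E))
    (ip : (E -> E) -> (E -> E) -> R) : Prop :=
  let nrm u := Num.sqrt (ip u u) in
  [/\ [/\ forall u, HV u -> forall i, measurable_fun (D : set (caratheodory_type _))
            (cmpt u i : caratheodory_type (@lebesgue_outer R d) -> R),
          forall (a : R) u v, HV u -> HV v -> HV (fun x => a *: u x + v x) &
          forall u, u = (fun=> 0) %[ae leb in D] -> HV u],
      [/\ forall u v, HV u -> HV v -> ip u v = ip v u,
          forall (a : R) u v z, HV u -> HV v -> HV z ->
            ip (fun x => a *: u x + v x) z = a * ip u z + ip v z,
          forall u, HV u -> 0 <= ip u u &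
          forall u, HV u -> (ip u u = 0 <-> u = (fun=> 0) %[ae leb in D])],
      forall un : nat -> E -> E, (forall n, HV (un n)) ->
        (forall e, 0 < e -> exists N, forall m n, (N <= m)%N -> (N <= n)%N ->
          nrm (un m \- un n) < e) ->
        exists u, HV u /\ (fun n => nrm (un n \- u)) @ \oo --> 0,
      V `<=` HV /\ (exists C, forall u v, V u -> V v ->
        nrm (u \- v) <= C * H1norm D (u \- v)) &
      forall u, HV u -> (forall v, V v -> ip u v = 0) -> ip u u = 0].

End sobolev.

Record state (R : realType) (d : nat) := State {
  vel : 'rV[R]_d -> 'rV[R]_d;
  prs : 'rV[R]_d -> R;
  dsp : 'rV[R]_d -> 'rV[R]_d
}.

Record setting (R : realType) (d : nat) := Setting {
  Omega : set 'rV[R]_d;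
  OmegaD : set 'rV[R]_d;
  OmegaN : set 'rV[R]_d;
  Body : set 'rV[R]_d;
  final_time : R;
  ug : 'rV[R]_d -> 'rV[R]_d;
  rhof : R;
  rhos0 : 'rV[R]_d -> R;
  muf : R;
  mus : R;
  W : 'M[R]_d -> R;
  body_force : R -> 'rV[R]_d -> 'rV[R]_d;
  traction : R -> 'rV[R]_d -> 'rV[R]_d;
  PhiB : R;
  Jm : R;
  HV : set ('rV[R]_d -> 'rV[R]_d);
  ipHV : ('rV[R]_d -> 'rV[R]_d) -> ('rV[R]_d -> 'rV[R]_d) -> R
}.

(* ProblemI: incompressible solid; ProblemC c1 c2: compressible solid, where the
   constant in {0, 1} is the boolean c2. *)
Inductive problem (R : realType) := ProblemI | ProblemC of R & bool.
Arguments ProblemI {R}.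

(* c times the integral of f over Omega, Body, or the Neumann boundary. *)
Inductive weighted_integral (R : realType) (d : nat) :=
  | IOmega of R & ('rV[R]_d -> R)
  | IBody of R & ('rV[R]_d -> R)
  | INeumann of R & ('rV[R]_d -> R).

Section fsi.
Context {R : realType} {d : nat}.
Local Notation E := 'rV[R]_d.
Local Notation M := 'M[R]_d.
Variable S : setting R d.
Local Notation Omega := (Omega S).
Local Notation OmegaD := (OmegaD S).
Local Notation OmegaN := (OmegaN S).
Local Notation Body := (Body S).
Local Notation W := (W S).
Local Notation rhof := (rhof S).
Local Notation rhos0 := (rhos0 S).

Definition velocity_space : set (E -> E) :=
  [set u | H1vec Omega u /\ is_trace Omega OmegaD u (ug S)].

Definition velocity_test_space : set (E -> E) :=
  [set v | H1vec Omega v /\ is_trace Omega OmegaD v (fun=> 0)].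

Definition pressure_space : set (E -> R) := [set q | Lp leb 2%:E Omega q].

Definition displacement_space : set (E -> E) :=
  [set w | L2vec Body w /\ exists G, is_weak_gradient Body w G /\ Lp_mat +oo%E Body G].

Definition in_trial_space (xi : state R d) : Prop :=
  [/\ velocity_space (vel xi), pressure_space (prs xi) & displacement_space (dsp xi)].

Definition in_test_space (psi : state R d) : Prop :=
  [/\ velocity_test_space (vel psi), pressure_space (prs psi) & H1vec Body (dsp psi)].

(* The set of tensors with positive determinant is not convex, so convexity of the
   energy is required along the segments contained in it. *)
Definition elastic_energy_ok : Prop :=
  (forall F : M, 0 < \det F ->
     differentiable W F /\ forall H : M, {for F, continuous ('D_H W)}) /\
  (forall F G : M,
     (forall l : R, 0 <= l <= 1 -> 0 < \det (l *: F + (1 - l) *: G)) ->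
     forall l : R, 0 <= l <= 1 ->
       W (l *: F + (1 - l) *: G) <= l * W F + (1 - l) * W G).

Record setting_ok : Prop := SettingOk {
  Omega_open : open Omega;
  Omega_bounded : bounded_set Omega;
  Body_open : open Body;
  Body_bounded : bounded_set Body;
  boundary_split : OmegaD `|` OmegaN = closure Omega `\` Omega;
  boundary_disjoint : OmegaD `&` OmegaN = set0;
  OmegaD_measurable : (hausdorff_outer R d d.-1).-cara.-measurable OmegaD;
  OmegaN_measurable : (hausdorff_outer R d d.-1).-cara.-measurable OmegaN;
  final_time_gt0 : 0 < final_time S;
  muf_gt0 : 0 < muf S;
  mus_ge0 : 0 <= mus S;
  energy_ok : elastic_energy_ok;
  PhiB_gt0 : 0 < PhiB S;
  Jm_gt0 : 0 < Jm S;
  HV_pivot : pivot_space Omega velocity_space (HV S) (ipHV S)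
}.

Definition motion (w : E -> E) (s : E) : E := s + w s.
Definition Fgrad (w : E -> E) (s : E) : M := 1%:M + weak_gradient Body w s.
Definition Jac (w : E -> E) (s : E) : R := \det (Fgrad w s).

Definition admissible_displacement (w : E -> E) : Prop :=
  [/\ diffeo_on Body (motion w), motion w @` Body `<=` Omega &
      {ae leb, forall s, Body s -> Jm S <= Jac w s}].

Definition dW (F : M) : M := \matrix_(i, j) 'D_(delta_mx i j) W F.
Definition Pe (w : E -> E) (s : E) : M := dW (Fgrad w s).

Definition viscous_stress (mu : R) (u : E -> E) (x : E) : M :=
  mu *: (weak_gradient Omega u x + (weak_gradient Omega u x)^T).

Definition divergence (u : E -> E) (x : E) : R := \tr (weak_gradient Omega u x).

Section functional.
Variables (P : problem R) (t : R) (xi xi' psi : state R d).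
Let u := vel xi.
Let p := prs xi.
Let w := dsp xi.
Let u' := vel xi'.
Let w' := dsp xi'.
Let v := vel psi.
Let q := prs psi.
Let y := dsp psi.
Let chi := motion w.
Let J := Jac w.
Let gu := weak_gradient Omega u.
Let gv := weak_gradient Omega v.
Let b := body_force S t.
Let Tf := viscous_stress (muf S) u.
Let Ts := viscous_stress (mus S) u.

Definition R1 : seq (weighted_integral R d) :=
  [:: IOmega 1 (fun x => rhof * dotv (u' x + appv (gu x) (u x)) (v x));
      IOmega 1 (fun x => frob (Tf x) (gv x));
      IOmega (-1) (fun x => p x * divergence v x);
      IBody 1 (fun s => (rhos0 s - rhof * J s) * dotv (u' (chi s)) (v (chi s)));
      IBody 1 (fun s => dotv (rhos0 s *: appv (gu (chi s)) (w' s)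
                              - (rhof * J s) *: appv (gu (chi s)) (u (chi s)))
                             (v (chi s)));
      IBody 1 (fun s => J s * frob (Ts (chi s) - Tf (chi s)) (gv (chi s)));
      IBody 1 (fun s => frob (Pe w s) (weak_gradient Body (v \o chi) s));
      IOmega (-1) (fun x => rhof * dotv (b x) (v x));
      INeumann (-1) (fun x => dotv (traction S t x) (trace Omega OmegaN v x));
      IBody (-1) (fun s => (rhos0 s - rhof * J s) * dotv (b (chi s)) (v (chi s)))]
  ++ (if P is ProblemC _ _ then
        [:: IBody 1 (fun s => J s * (p (chi s) * divergence v (chi s)))]
      else [::]).

Definition R2 : seq (weighted_integral R d) :=
  [:: IOmega (-1) (fun x => q x * divergence u x)]
  ++ (if P is ProblemC c1 c2 then
        [:: IBody 1 (fun s => J s * (q (chi s) * divergence u (chi s)));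
            IBody c1 (fun s => J s * (p (chi s) * q (chi s)))]
        ++ (if c2 then
              [:: IBody c1 (fun s => (\tr (1%:M : M))^-1
                    * (frob (J s *: Ts (chi s)) 1%:M + frob (Pe w s) (Fgrad w s))
                    * q (chi s))]
            else [::])
      else [::]).

Definition R3 : seq (weighted_integral R d) :=
  [:: IBody (PhiB S) (fun s => dotv (w' s - u (chi s)) (y s))].

Definition integral_value (I : weighted_integral R d) : R :=
  match I with
  | IOmega c f => c * \int[leb]_(x in Omega) f x
  | IBody c f => c * \int[leb]_(s in Body) f s
  | INeumann c f => c * \int[hausdorff R d d.-1]_(x in OmegaN) f x
  end.

Definition integral_exists (I : weighted_integral R d) : Prop :=
  match I with
  | IOmega _ f => leb.-integrable Omega (EFin \o f)
  | IBody _ f => leb.-integrable Body (EFin \o f)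
  | INeumann _ f => (hausdorff R d d.-1).-integrable OmegaN (EFin \o f)
  end.

Definition functional : R := \sum_(I <- R1 ++ R2 ++ R3) integral_value I.

Definition functional_exists : Prop :=
  List.Forall integral_exists (R1 ++ R2 ++ R3).

(* The library gives meaningless values to integrals that do not exist, so the
   equation also asserts that every integral in it exists. *)
Definition functional_vanishes : Prop := functional_exists /\ functional = 0.

End functional.

Definition time_derivative (xi : R -> state R d) (t : R) : state R d :=
  State (fun x => derive1 (fun r => vel (xi r) x) t)
        (fun x => derive1 (fun r => prs (xi r) x) t)
        (fun s => derive1 (fun r => dsp (xi r) s) t).

Record exact_solution (P : problem R) (xi0 : state R d) (xi : R -> state R d) : Prop :=
  ExactSolution {
    initial_state_ok : in_trial_space xi0;
    initial_condition : xi 0 = xi0;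
    solution_in_space : forall t, 0 < t < final_time S -> in_trial_space (xi t);
    solution_motion : forall t, 0 < t < final_time S ->
      admissible_displacement (dsp (xi t));
    velocity_derivable : forall t, 0 < t < final_time S ->
      {ae leb, forall x, Omega x -> derivable (fun r => vel (xi r) x) t 1};
    displacement_derivable : forall t, 0 < t < final_time S ->
      {ae leb, forall s, Body s -> derivable (fun r => dsp (xi r) s) t 1};
    velocity_rate_space : forall t, 0 < t < final_time S ->
      HV S (vel (time_derivative xi t));
    displacement_rate_space : forall t, 0 < t < final_time S ->
      H1vec Body (dsp (time_derivative xi t));
    solution_equation : forall t, 0 < t < final_time S ->
      forall psi, in_test_space psi ->
        functional_vanishes P t (xi t) (time_derivative xi t) psi
  }.

End fsi.

Section finite_elements.
Context {R : realType} {d : nat}.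
Local Notation E := 'rV[R]_d.

(* Cells are represented by their interiors: the skeleton is a null set, and finite
   element functions are constrained on the interiors only. *)
Definition decomposition (D : set E) (n : nat) (K : 'I_n -> set E) : Prop :=
  [/\ forall k, open (K k) /\ K k !=set0, trivIset setT K,
      forall k, K k `<=` D &
      leb.-negligible (D `\` \bigcup_(k in setT) K k)].

Definition polynomial_on (K : set E) (f : E -> R) : Prop :=
  exists p : mpoly.mpoly d R, forall x, K x -> f x = mpoly.meval (x 0) p.

Definition piecewise_polynomial (n : nat) (K : 'I_n -> set E) (f : E -> R) : Prop :=
  forall k, polynomial_on (K k) f.

Definition fspan (V : lmodType R) (N : nat) (f : 'I_N -> E -> V) : set (E -> V) :=
  [set g | exists c : 'I_N -> R, g = (fun x => \sum_i c i *: f i x)].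

Definition independent_on (D : set E) (V : lmodType R) (N : nat)
    (f : 'I_N -> E -> V) : Prop :=
  forall c : 'I_N -> R,
    (fun x => \sum_i c i *: f i x) = (fun=> 0) %[ae leb in D] -> forall i, c i = 0.

End finite_elements.

Record discretization (R : realType) (d : nat) := Discretization {
  cells_Omega : nat;
  cell_Omega : 'I_cells_Omega -> set 'rV[R]_d;
  cells_Body : nat;
  cell_Body : 'I_cells_Body -> set 'rV[R]_d;
  NV : nat;
  NQ : nat;
  NY : nat;
  vh : 'I_NV -> 'rV[R]_d -> 'rV[R]_d;
  qh : 'I_NQ -> 'rV[R]_d -> R^o;
  yh : 'I_NY -> 'rV[R]_d -> 'rV[R]_d
}.

Arguments cell_Omega {R d}.
Arguments cell_Body {R d}.
Arguments vh {R d}.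
Arguments qh {R d}.
Arguments yh {R d}.

Section discrete.
Context {R : realType} {d : nat}.
Variables (S : setting R d) (Th : discretization R d).

Definition Vh := fspan (vh Th).
Definition Qh := fspan (qh Th).
Definition Yh := fspan (yh Th).

Record discretization_ok : Prop := DiscretizationOk {
  Omega_decomposition : decomposition (Omega S) (cell_Omega Th);
  Body_decomposition : decomposition (Body S) (cell_Body Th);
  vh_polynomial : forall a i,
    piecewise_polynomial (cell_Omega Th) (cmpt (vh Th a) i);
  qh_polynomial : forall a, piecewise_polynomial (cell_Omega Th) (qh Th a);
  yh_polynomial : forall a i,
    piecewise_polynomial (cell_Body Th) (cmpt (yh Th a) i);
  vh_independent : independent_on (Omega S) (vh Th);
  qh_independent : independent_on (Omega S) (qh Th);
  yh_independent : independent_on (Body S) (yh Th)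
}.

Definition conforming : Prop :=
  [/\ Vh `<=` velocity_space S, Qh `<=` pressure_space S &
      Yh `<=` displacement_space S].

Definition psih (i : 'I_(NV Th + NQ Th + NY Th)) : state R d :=
  match fintype.split i with
  | inl j => match fintype.split j with
             | inl a => State (vh Th a) (fun=> 0) (fun=> 0)
             | inr a => State (fun=> 0) (qh Th a) (fun=> 0)
             end
  | inr a => State (fun=> 0) (fun=> 0) (yh Th a)
  end.

Definition semidiscrete_equations (P : problem R) (t : R) (xi xi' : state R d) : Prop :=
  forall i, functional_vanishes S P t xi xi' (psih i).

Definition strongly_consistent (P : problem R) : Prop :=
  forall xi0 xi, exact_solution S P xi0 xi ->
    forall t, 0 < t < final_time S ->
      semidiscrete_equations P t (xi t) (time_derivative xi t).

End discrete.

(* Main.v *)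
Require Import Defs.
From mathcomp Require Import all_boot all_order all_algebra.
From mathcomp Require Import all_classical all_reals all_analysis.
From mathcomp Require Import ess_sup_inf measurable_realfun lra.

Import Order.TTheory GRing.Theory Num.Theory.
Import numFieldNormedType.Exports.
Local Open Scope classical_set_scope.
Local Open Scope ring_scope.

(* The equation of the exact problem holds for every test triple, so it suffices
   that each discrete basis triple is one.  For velocities, the zero field and each
   basis field both have trace ug on OmegaD, hence their difference has trace 0.
   For displacements, an essentially bounded gradient is square integrable because
   Body has finite measure.  Both steps need open sets to be measurable, for the
   additivity of integrals: a half-space cuts each covering box into two boxes of
   the same total volume, so it satisfies Caratheodory's criterion, and an open set
   is a countable union of half-open boxes. *)

(** * Outer measures generated by covers *)

Section cover_outer_caratheodory.
Context {R : realType} {T : pointedType} (c : set T -> \bar R).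

(** [A] followed by empty sets, which cost nothing, is a cover of [A]. *)
Lemma cover_outer_le_cost A : (cover_outer c A <= cost c A)%E.
Proof.
pose F (n : nat) := if n is 0%N then A else set0.
apply: ereal_inf_lbound; exists F.
  split; first by move=> n; exact: sub_sigma_algebra.
  by move=> x Ax; exists 0%N.
rewrite (nneseries_split 0%N 1%N); last by move=> n _; exact: cost_ge0.
rewrite addn1 big_nat1 eseries0 ?adde0// => -[|n] // _ _.
exact: cost0.
Qed.

(** A cover of [A], intersected with [H] and with its complement, covers both pieces; the inequality
    for single sets is then summed over the cover. *)
Lemma cover_outer_split H :
  (forall F, cost c (F `&` H) + cost c (F `&` ~` H) <= cost c F)%E ->
  forall A, (cover_outer c (A `&` H) + cover_outer c (A `&` ~` H) <=
    cover_outer c A)%E.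
Proof.
move=> cH A; apply: le_ereal_inf_tmp => _ [F [_ AF] <-].
have coverI B : (cover_outer c (A `&` B) <= \sum_(k <oo) cost c (F k `&` B))%E.
  apply: ereal_inf_lbound; exists (fun k => F k `&` B) => //.
  split; first by move=> n; exact: sub_sigma_algebra.
  by move=> x [/AF [k _ Fkx] Bx]; exists k.
apply: le_trans (leeD (coverI H) (coverI (~` H))) _.
rewrite -nneseriesD; [|by move=> *; exact: cost_ge0..].
apply: lee_nneseries => [k _ _|k _]; last exact: cH.
by rewrite adde_ge0// cost_ge0.
Qed.

End cover_outer_caratheodory.

(** * Lebesgue measurability of open sets, finite measure of bounded sets *)

Section open_measurable.
Context {R : realType} {d : nat}.
Local Notation E := 'rV[R]_d.

(* The cost from which lebesgue_outer is built. *)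
Definition box_cost (F : set E) : \bar R := ereal_inf
  [set (box_volume ab.1 ab.2)%:E | ab in [set ab : E * E | F `<=` box ab.1 ab.2]].

Lemma box_volume_ge0 (a b : E) : 0 <= box_volume a b.
Proof. by apply: prodr_ge0 => i _; rewrite le_max lexx. Qed.

Lemma cost_box_ge (F : set E) (a b : E) : F `<=` box a b ->
  (cost box_cost F <= (box_volume a b)%:E)%E.
Proof.
move=> Fab; rewrite /cost; case: ifP => _; first by rewrite lee_fin box_volume_ge0.
rewrite ge_max lee_fin box_volume_ge0/=.
by apply: ereal_inf_lbound; exists (a, b).
Qed.

Definition halfspace (i : 'I_d) (r : R) : set E := [set x | x 0 i <= r].

(** Only the [i]-th factors differ, and the truncated side lengths add up wherever [r] lies, even
    for an empty box. *)
Lemma box_volume_split (i : 'I_d) (r : R) (a b : E) :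
  box_volume a (\row_j (if j == i then Num.min (b 0 j) r else b 0 j)) +
  box_volume (\row_j (if j == i then Num.max (a 0 j) r else a 0 j)) b =
  box_volume a b.
Proof.
rewrite /box_volume (bigD1 i)//= [X in _ + X](bigD1 i)//= [RHS](bigD1 i)//=.
rewrite !mxE eqxx.
under eq_bigr => j /negbTE ji do rewrite mxE ji.
under [X in _ + _ * X]eq_bigr => j /negbTE ji do rewrite mxE ji.
rewrite -mulrDl; congr (_ * _).
case: (leP (b 0 i) r) => br; case: (leP (a 0 i) r) => ar; rewrite /Order.max;
  by repeat (case: ifPn; rewrite -?leNgt; intro); lra.
Qed.

Lemma cost_halfspace (i : 'I_d) (r : R) (F : set E) :
  (cost box_cost (F `&` halfspace i r) + cost box_cost (F `&` ~` halfspace i r)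
   <= cost box_cost F)%E.
Proof.
rewrite {3}/cost; case: ifPn => [/eqP->|_]; first by rewrite !set0I cost0 adde0.
apply: le_trans; last by rewrite le_max; apply/orP; right.
apply: le_ereal_inf_tmp => _ [[a b] /= Fab <-].
(* The hyperplane cuts a box covering [F] into two closed boxes, one covering each piece of [F]. *)
rewrite -(box_volume_split i r a b) EFinD; apply: leeD; apply: cost_box_ge.
  move=> x [/Fab xab xr] j; rewrite mxE; have := xab j; move: xr; rewrite /halfspace/=.
  by case: eqP => [->|//] xr /andP[-> xb]/=; rewrite le_min xb.
move=> x [/Fab xab /negP]; rewrite -ltNge => xr j; rewrite mxE; have := xab j.
by case: eqP => [->|//] /andP[xa ->]; rewrite ge_max xa (ltW xr).
Qed.

Lemma halfspace_measurable (i : 'I_d) (r : R) :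
  (@lebesgue_outer R d).-cara.-measurable (halfspace i r).
Proof.
apply: le_caratheodory_measurable => A.
exact: (@cover_outer_split R E box_cost _ (cost_halfspace i r) A).
Qed.

(** Half-open boxes are finite intersections of half-spaces and complements of half-spaces. *)
Lemma half_open_box_measurable (a b : E) : (@lebesgue_outer R d).-cara.-measurable
  ([set x | forall i, a 0 i < x 0 i <= b 0 i] : set E).
Proof.
rewrite [X in measurable X](_ : _ =
  \bigcap_(i : 'I_d) (halfspace i (b 0 i) `&` ~` halfspace i (a 0 i))).
  rewrite -[X in measurable X]setCK setC_bigcap; apply: measurableC.
  apply: countable_bigcupT_measurable => [|i]; first exact: countableP.
  apply: measurableC.
  by apply: measurableI; [|apply: measurableC]; exact: halfspace_measurable.
apply/seteqP; split => x /= xab i; rewrite ?inE.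
  by move=> _; have /andP[? ?] := xab i; split => //; apply/negP; rewrite -ltNge.
by have [? /negP] := xab i I; rewrite -ltNge => ->.
Qed.

Lemma open_lebesgue_measurable (U : set E) : open U ->
  (@lebesgue_outer R d).-cara.-measurable U.
Proof.
move=> oU.
(* Rational corners make the family countable; boxes not inside [U] are replaced by the empty
   set. *)
pose B (q : 'rV[rat]_d * 'rV[rat]_d) : set E :=
  [set x | forall i, ratr (q.1 0 i) < x 0 i <= ratr (q.2 0 i)].
rewrite [U](_ : _ = \bigcup_(q : 'rV[rat]_d * 'rV[rat]_d)
    (if `[< B q `<=` U >] then B q else set0)); last first.
  apply/seteqP; split => [x Ux|x [q _]]; last by case: asboolP => // + Bx; exact.
  have /nbhs_ballP[e /= e0 eU] : nbhs x U by exact: open_nbhs_nbhs.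
  (* Rational bounds within [e] on either side of each coordinate: the resulting box lies in the
     sup-norm ball of radius [e], hence in [U]. *)
  have /choice[f fx] i : exists q : rat * rat,
      [/\ x 0 i - e < ratr q.1, ratr q.1 < x 0 i, x 0 i < ratr q.2
        & ratr q.2 < x 0 i + e].
    have [|a] := @rat_in_itvoo R (x 0 i - e) (x 0 i); first by rewrite ltrBlDr ltrDl.
    rewrite in_itv => /andP[a1 a2].
    have [|b] := @rat_in_itvoo R (x 0 i) (x 0 i + e); first by rewrite ltrDl.
    by rewrite in_itv => /andP[b1 b2]; exists (a, b).
  exists (\row_i (f i).1, \row_i (f i).2) => //; case: asboolP => [_ i|].
    by rewrite !mxE; have [_ -> /ltW -> _] := fx i.
  move=> [] y yB; apply: eU; rewrite mx_norm_ball /ball_ /=.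
  rewrite {1}/Num.norm/= mx_normrE; apply/bigmax_ltP; split=> // -[k i] _ /=.
  rewrite ord1 !mxE ltr_norml; have := yB i; rewrite !mxE => /andP[y1 y2].
  by have [? ? ? ?] := fx i; apply/andP; split; lra.
apply: countable_bigcupT_measurable => [|q]; first exact: countableP.
case: asboolP => // _.
have := half_open_box_measurable (map_mx ratr q.1) (map_mx ratr q.2).
by congr measurable; apply/seteqP; split => x /= h i; have := h i; rewrite !mxE.
Qed.

(** For the sup norm, a bounded set lies in a cube with sides [[-M, M]], of finite volume. *)
Lemma bounded_lebesgue_lty (A : set E) : bounded_set A -> (lebesgue_outer A < +oo)%E.
Proof.
move=> /pinfty_ex_gt0[M M0 AM].
apply: le_lt_trans (cover_outer_le_cost box_cost A) _.
apply: (@le_lt_trans _ _ (box_volume (const_mx (- M)) (const_mx M) : R)%:E);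
  last by rewrite ltry.
apply: cost_box_ge => x /AM xM i; rewrite !mxE -ler_norml; apply: le_trans xM.
rewrite [leRHS]/Num.norm/= mx_normrE.
exact: (le_bigmax _ (fun ij : 'I_1 * 'I_d => `|x ij.1 ij.2|) (0, i)).
Qed.

End open_measurable.

(** * Differences in Lebesgue spaces, and bounded functions on sets of finite measure *)

Section Lp_difference.
Context {disp : measure_display} {T : measurableType disp} {R : realType}.
Variable mu : {measure set T -> \bar R}.

Lemma restrictB (D : set T) (f g : T -> R) : (f \- g) \_ D = f \_ D \- g \_ D.
Proof. by apply/funext => x; rewrite /patch/=; case: ifP => // _; rewrite subr0. Qed.

Lemma LpB {p} {D : set T} {f g : T -> R} : (1 <= p)%E ->
  Lp mu p D f -> Lp mu p D g -> Lp mu p D (f \- g).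
Proof. by move=> p1 fD gD; rewrite /Lp restrictB; exact: (@rpredB _ (Lfun mu p)). Qed.

Lemma Lp_measurable {p} {D : set T} {f : T -> R} : Lp mu p D f ->
  measurable_fun setT (f \_ D).
Proof. by move=> /andP[/[!inE]]. Qed.

Lemma cvgL2B {D : set T} {fn gn : nat -> T -> R} {f g : T -> R} :
  cvgL2 mu D fn f -> cvgL2 mu D gn g ->
  cvgL2 mu D (fun n => fn n \- gn n) (f \- g).
Proof.
move=> [fnD fD fnf] [gnD gD gng].
have le12 : (1 <= 2%:E :> \bar R)%E by rewrite lee_fin ler1n.
split; [by move=> n; exact: LpB|exact: LpB|].
apply: (squeeze_cvge (f := cst 0%E) (h := fun n =>
  ('N[mu]_2%:E [EFin \o ((fn n \- f)%R \_ D)] +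
   'N[mu]_2%:E [EFin \o ((gn n \- g)%R \_ D)])%E)).
- apply: nearW => n; rewrite /= Lnorm_ge0/=.
  (* Regrouped as a sum for Minkowski's inequality; the norm ignores the sign of the second term. *)
  have -> : (fn n \- gn n \- (f \- g)) \_ D =
      ((fn n \- f) \_ D \+ (\- ((gn n \- g) \_ D)))%R.
    apply/funext => x; rewrite /patch/=; case: ifP => _ /=; [lra|by rewrite oppr0 addr0].
  apply: le_trans (eminkowski _ _ _ le12) _.
  + exact: Lp_measurable (LpB le12 (fnD n) fD).
  + by apply: measurableT_comp => //; exact: Lp_measurable (LpB le12 (gnD n) gD).
  + rewrite leeD2l// -[leRHS]oppe_Lnorm; exact: lexx.
- exact: cvg_cst.
- by rewrite -[X in _ --> X](adde0 0%E); exact: cvgeD.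
Qed.

(* Lfun_subset would require the ambient measure, not just mu D, to be finite. *)
Lemma Lp_infty_L2 (D : set T) (f : T -> R) : measurable D -> (mu D < +oo)%E ->
  Lp mu +oo D f -> Lp mu 2%:E D f.
Proof.
move=> mD Doo /[dup] /Lp_measurable mf /andP[mf' /[!inE]/=].
rewrite /finite_norm unlock => foo.
have {foo} [M fM] : exists M : R, {ae mu, forall x, `|(f \_ D) x| <= M}.
  have [mu0|mu0] := ltP 0%E (mu setT).
    by rewrite mu0 in foo; exact: ess_supr_bounded.
  (* If the whole space is null, the norm gives no bound, but any bound holds almost everywhere. *)
  exists 0; exists setT; split => //.
  by apply/eqP; rewrite eq_le mu0 measure_ge0.
apply/andP; split => //; rewrite inE/= /finite_norm unlock poweR_lty//.
rewrite (_ : (fun x => _) =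
  (fun x => (`|((f \_ D) x)%:E| `^ 2)%E) \_ D); last first.
  by apply/funext => x; rewrite /patch/=; case: ifP => // _; rewrite normr0 powR0.
rewrite -integral_mkcond.
(* The square is dominated almost everywhere by a constant, integrable as [D] has finite measure. *)
apply: (@le_lt_trans _ _ (\int[mu]_(x in D) cst ((`|M| `^ 2)%:E) x)%E).
  apply: ae_ge0_le_integral => //.
  - by move=> x _; rewrite lee_fin powR_ge0.
  - apply: (@measurable_funS _ _ _ _ setT) => //.
    apply/measurable_EFinP; apply: (measurableT_comp (measurable_powR _)).
    exact: measurableT_comp.
  - by move=> x _; rewrite lee_fin powR_ge0.
  apply: filterS fM => x fM _; rewrite lee_fin ge0_ler_powR ?nnegrE//.
  exact: le_trans (ler_norm M).
by rewrite integral_cst// lte_mul_pinfty// lee_fin powR_ge0.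
Qed.

End Lp_difference.

(** * Discrete basis triples as test triples *)

Section test_spaces.
Context {R : realType} {d : nat}.
Local Notation E := 'rV[R]_d.

Lemma partialB (j : 'I_d) (f g : E -> R) :
  (forall x, differentiable f x) -> (forall x, differentiable g x) ->
  partial j (f \- g) = partial j f \- partial j g.
Proof.
move=> df dg; apply/funext => x; apply: deriveB; exact: diff_derivable.
Qed.

Lemma CkB k (f g : E -> R) : Ck k f -> Ck k g -> Ck k (f \- g).
Proof.
elim: k f g => [f g cf cg x|k IH f g /= [df cf] [dg cg]].
  exact: (cvgB (cf x) (cg x)).
split=> [x|j]; first exact: differentiableB.
by rewrite partialB//; exact: IH.
Qed.

Lemma smooth_differentiable (f : E -> R) : smooth f ->
  forall x, differentiable f x.
Proof. by move=> /(_ 1%N)[]. Qed.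

Lemma is_weak_gradientB (D : set E) (u v : E -> E) (G H : E -> 'M[R]_d) :
  open D -> is_weak_gradient D u G -> is_weak_gradient D v H ->
  is_weak_gradient D (u \- v) (G \- H).
Proof.
move=> /open_lebesgue_measurable mD uG vH i j phi tphi.
have [iu iG uGE] := uG i j phi tphi.
have [iv iH vHE] := vH i j phi tphi.
have uvE : cmpt (u \- v) i \* partial j phi =
    (cmpt u i \* partial j phi) \- (cmpt v i \* partial j phi).
  by apply/funext => x; rewrite /cmpt/= !mxE mulrBl.
have GHE : mcmpt (G \- H) i j \* phi = (mcmpt G i j \* phi) \- (mcmpt H i j \* phi).
  by apply/funext => x; rewrite /mcmpt/= !mxE mulrBl.
split.
- by rewrite uvE; exact: (integrableB mD iu iv).
- by rewrite GHE; exact: (integrableB mD iG iH).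
- transitivity (\int[leb]_(x in D)
      (cmpt u i x * partial j phi x - cmpt v i x * partial j phi x)).
    by congr Rintegral; exact: uvE.
  transitivity (- (\int[leb]_(x in D)
      (mcmpt G i j x * phi x - mcmpt H i j x * phi x))); last first.
    by congr (- Rintegral _ _ _); exact/esym/GHE.
  by rewrite !RintegralB// uGE vHE opprB opprK addrC.
Qed.

(** The termwise difference of the two smooth approximating sequences approximates the difference,
    in the domain and on [Gamma]. *)
Lemma is_traceB (D Gamma : set E) (u v g h : E -> E) : open D ->
  is_trace D Gamma u g -> is_trace D Gamma v h ->
  is_trace D Gamma (u \- v) (g \- h).
Proof.
move=> oD [G [un [uG su un_u pun_G un_g]]] [H [vn [vH sv vn_v pvn_H vn_h]]].
have cB (f f' : E -> E) i : cmpt (f \- f') i = cmpt f i \- cmpt f' i.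
  by apply/funext => x; rewrite /cmpt/= !mxE.
exists (G \- H), (fun n => un n \- vn n); split.
- exact: is_weak_gradientB.
- by move=> n i k; rewrite cB; apply: CkB; [exact: su|exact: sv].
- move=> i; rewrite cB; under eq_fun do rewrite cB.
  exact: cvgL2B (un_u i) (vn_v i).
- move=> i j; rewrite (_ : mcmpt _ _ _ = mcmpt G i j \- mcmpt H i j); last first.
    by apply/funext => x; rewrite /mcmpt/= !mxE.
  under eq_fun => n.
    rewrite cB partialB; [|exact: smooth_differentiable..].
    over.
  exact: cvgL2B (pun_G i j) (pvn_H i j).
- move=> i; rewrite cB; under eq_fun do rewrite cB.
  exact: cvgL2B (un_g i) (vn_h i).
Qed.

Lemma displacement_space_H1 (S : setting R d) (w : E -> E) :
  open (Body S) -> bounded_set (Body S) ->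
  displacement_space S w -> H1vec (Body S) w.
Proof.
move=> oB bB [w2 [G [wG Goo]]]; split=> //; exists G; split=> // i j.
apply: Lp_infty_L2 (Goo i j); first exact: open_lebesgue_measurable.
exact: bounded_lebesgue_lty.
Qed.

(* The zero field lies in Vh, so a conforming Vh forces ug to be a trace of 0, and
   subtracting it shows that every element of Vh has trace 0 on OmegaD. *)
Lemma velocity_space_test (S : setting R d) (v : E -> E) : open (Omega S) ->
  velocity_space S (fun=> 0) -> velocity_space S v -> velocity_test_space S v.
Proof.
move=> oO [_ t0] [Hv tv]; split=> //.
have := is_traceB _ _ _ _ _ _ oO tv t0.
by congr is_trace; apply/funext => x /=; rewrite ?subr0 ?subrr.
Qed.

Lemma fspan_zero (V : lmodType R) (N : nat) (f : 'I_N -> E -> V) :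
  fspan f (fun=> 0).
Proof.
exists (fun=> 0); apply/funext => x.
by rewrite big1// => i _; rewrite scale0r.
Qed.

Lemma fspan_gen (V : lmodType R) (N : nat) (f : 'I_N -> E -> V) (a : 'I_N) :
  fspan f (f a).
Proof.
exists (fun i => (i == a)%:R); apply/funext => x.
rewrite (bigD1 a)//= eqxx scale1r big1 ?addr0// => i /negbTE ->.
by rewrite scale0r.
Qed.

Lemma psih_in_test_space (S : setting R d) (Th : discretization R d)
    (i : 'I_(NV Th + NQ Th + NY Th)) :
  setting_ok S -> conforming S Th -> in_test_space S (psih i).
Proof.
move=> hS [hV hQ hY].
(* Each basis triple has two zero components, which must be test functions too; the spans contain
   zero even when a basis family is empty. *)
have V0 := hV _ (fspan_zero _ _ (vh Th)).
have Q0 := hQ _ (fspan_zero _ _ (qh Th)).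
have Y0 := hY _ (fspan_zero _ _ (yh Th)).
have VT v : velocity_space S v -> velocity_test_space S v.
  exact: velocity_space_test (Omega_open hS) V0.
have YT w : displacement_space S w -> H1vec (Body S) w.
  exact: displacement_space_H1 (Body_open hS) (Body_bounded hS).
rewrite /psih; case: fintype.split => [j|a]; first case: fintype.split => a.
- split; [exact/VT/hV/fspan_gen|exact: Q0|exact/YT/Y0].
- split; [exact/VT/V0|exact/hQ/fspan_gen|exact/YT/Y0].
- split; [exact/VT/V0|exact: Q0|exact/YT/hY/fspan_gen].
Qed.

End test_spaces.

Theorem theorem6 (R : realType) (d : nat) (hd : d = 2%N \/ d = 3%N)
    (S : setting R d) (hS : setting_ok S)
    (Th : discretization R d) (hTh : discretization_ok S Th)
    (hconf : conforming S Th) :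
  strongly_consistent S Th ProblemI /\
  (forall (c1 : R) (c2 : bool), 0 < c1 -> strongly_consistent S Th (ProblemC c1 c2)).
Proof.
(* The argument is uniform in the problem: the exact equation is evaluated at the test triple
   [psih i]. *)
have consistent P : strongly_consistent S Th P.
  move=> xi0 xi sol t ht i; apply: (solution_equation sol) => //.
  exact: psih_in_test_space.
by split=> [|c1 c2 _]; exact: consistent.
Qed.
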